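(* Let $K$ be a compact metric space, $\Phi=\{\varphi_1,\dots,\varphi_n\}$ a system of linearly independent functions in $C(K)$, and $f\in C(K)$. Suppose the regular case takes place for Algorithm 1 (defined in the context) with regularity parameter $\mu>0$. Then Algorithm 1 converges linearly: $$B_{k+1}-b_{k+1}\ \le\ (1-\mu)^k\,(B_1-b_1)$$ for every $k\in\mathbb{N}$ for which the $k$-th iteration is performed.
   Context: $\|g\|=\max_{t\in K}|g(t)|$ is the uniform norm on $C(K)$. $\mathcal{P}$ is the linear span of $\Phi$, and its elements are called polynomials. The moment vector is $\boldsymbol{u}(t)=(\varphi_1(t),\dots,\varphi_n(t))^T\in\mathbb{R}^n$. A system of $N\ge n$ vectors in $\mathbb{R}^n$ is nondegenerate if every $n$ of its vectors are linearly independent. Algorithm 1 (input: $\Phi$, $f$, $\varepsilon>0$). Initialization. Take $n+1$ different points $t_1,\dots,t_{n+1}\in K$ such that $\{\boldsymbol{u}(t_i)\}_{i=1}^{n+1}$ is nondegenerate. Let $(x_1,\dots,x_{n+1})$ be the nonzero solution (unique up to a factor) of $\sum_{i=1}^{n+1}x_i\boldsymbol{u}(t_i)=0$ and let $\sigma_i$ be the sign of $x_i$. Find $p\in\mathcal{P}$ and $d\in\mathbb{R}$ from the linear system $p(t_i)=f(t_i)+\sigma_i d$, $i=1,\dots,n+1$. If $d<0$, change all signs $\sigma_i$, so that $d$ becomes $-d\ge 0$. Set $p_1=p$, $b_1=d$, $B_1=\|p_1-f\|$. The $k$-th iteration, $k\ge1$, performed as long as $B_k-b_k\ge\varepsilon$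 (the algorithm stops as soon as $B_k-b_k<\varepsilon$). At its start there are a polynomial $p_k\in\mathcal{P}$, points $t_1,\dots,t_{n+1}\in K$ (depending on $k$), signs $\sigma_i\in\{-1,1\}$ and numbers $B_k>b_k\ge0$ such that $p_k(t_i)=f(t_i)+\sigma_i b_k$ for all $i$, and, with $\boldsymbol{a}_i=\sigma_i\boldsymbol{u}(t_i)$, the simplex $\Delta_k=\mathrm{co}\{\boldsymbol{a}_1,\dots,\boldsymbol{a}_{n+1}\}$ contains the origin in its interior: $0=\sum_{i=1}^{n+1}\beta_i\boldsymbol{a}_i$ with all $\beta_i>0$ and $\sum_i\beta_i=1$. Let $r_k=\|p_k-f\|$, choose $t_0\in K$ with $|p_k(t_0)-f(t_0)|=r_k$, let $\sigma_0$ be the sign of $p_k(t_0)-f(t_0)$ and $\boldsymbol{a}_0=\sigma_0\boldsymbol{u}(t_0)$. Solve $\boldsymbol{a}_0=\sum_{i=1}^{n+1}x_i\boldsymbol{a}_i$ and let $s\in\{1,\dots,n+1\}$ be an index for which the ratio $x_i/\beta_i$ is maximal. Then the convex hull of $\{\boldsymbol{a}_i:0\le i\le n+1,\ i\ne s\}$ contains the origin. Let $0=\sum_{0\le i\le n+1,\,i\ne s}\alpha_i^{(k)}\boldsymbol{a}_i$ be the corresponding convex combination ($\alpha_i^{(k)}\ge0$, $\sum_i\alpha_i^{(k)}=1$). Find $p_{k+1}\in\mathcal{P}$ and $b_{k+1}$ from the linear system $p_{k+1}(t_i)=f(t_i)+\sigma_i b_{k+1}$, $0\le i\le n+1$, $i\ne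 s$. Set $B_{k+1}=\min\{r_k,B_k\}$. Relabel the points $\{t_i\}_{i\ne s}$ (with their signs) as $t_1,\dots,t_{n+1}$ and pass to the next iteration. Regular case with regularity parameter $\mu>0$: in each iteration $k$ performed, the system $\{\boldsymbol{a}_i\}_{i=0}^{n+1}$ is nondegenerate and $\alpha_0^{(k)}\ge\mu$. *)

(* Defs.v *)
(* MathComp-Analysis *)
From HB Require Import structures.
From mathcomp Require Import all_boot all_order all_algebra.
From mathcomp Require Import all_classical all_reals all_analysis.
Set Implicit Arguments.
Unset Strict Implicit.
Unset Printing Implicit Defensive.
Import Order.TTheory GRing.Theory Num.Theory.
Import numFieldNormedType.Exports.
Local Open Scope classical_set_scope.
Local Open Scope ring_scope.

(* For [g] continuous on a nonempty compact [K] the supremum is a maximum. *)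
Definition unorm (R : realType) (K : Type) (g : K -> R) : R :=
  sup (range (fun t => `|g t|)).

Definition lin_indep (R : realType) (K : Type) (n : nat)
    (phi : 'I_n -> K -> R) : Prop :=
  forall c : 'I_n -> R,
    (forall t, \sum_(i < n) c i * phi i t = 0) -> forall i, c i = 0.

Definition polynomial (R : realType) (K : Type) (n : nat)
    (phi : 'I_n -> K -> R) (p : K -> R) : Prop :=
  exists c : 'I_n -> R, forall t, p t = \sum_(i < n) c i * phi i t.

Definition moment (R : realType) (K : Type) (n : nat)
    (phi : 'I_n -> K -> R) (t : K) : 'cV[R]_n := \col_(i < n) phi i t.

(* Systems are indexed families: equal vectors at two distinct indices count
   as a linearly dependent pair. *)
Definition nondegenerate (R : realType) (n : nat) (I : finType)
    (v : I -> 'cV[R]_n) : Prop :=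
  (n <= #|I|)%N /\
  forall A : {set I}, #|A| = n -> free [seq v i | i in A].

(* The data produced by a run.  The first argument of every field is the
   number k >= 1 of the iteration; values at k = 0 and after the stop of the
   algorithm carry no meaning.  The indices 1..n+1 are the elements of
   ['I_n.+1]; the indices 0..n+1 are the elements of [option 'I_n.+1], with
   [None] for 0.  The value [r_alpha k (Some (r_s k))] is not used. *)
Record run (R : realType) (K : Type) (n : nat) := Run {
  r_p : nat -> K -> R;
  r_b : nat -> R;
  r_B : nat -> R;
  r_t : nat -> 'I_n.+1 -> K;
  r_sigma : nat -> 'I_n.+1 -> R;
  r_beta : nat -> 'I_n.+1 -> R;
  r_t0 : nat -> K;
  r_x : nat -> 'I_n.+1 -> R;
  r_s : nat -> 'I_n.+1;
  r_alpha : nat -> option 'I_n.+1 -> R }.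

Definition err (R : realType) (K : Type) (n : nat) (f : K -> R)
    (r : run R K n) (k : nat) (t : K) : R := r_p r k t - f t.

Definition ext_t (R : realType) (K : Type) (n : nat) (r : run R K n)
    (k : nat) (i : option 'I_n.+1) : K :=
  if i is Some j then r_t r k j else r_t0 r k.

Definition ext_sigma (R : realType) (K : Type) (n : nat) (f : K -> R)
    (r : run R K n) (k : nat) (i : option 'I_n.+1) : R :=
  if i is Some j then r_sigma r k j else Num.sg (err f r k (r_t0 r k)).

Definition ext_a (R : realType) (K : Type) (n : nat) (phi : 'I_n -> K -> R)
    (f : K -> R) (r : run R K n) (k : nat) (i : option 'I_n.+1) : 'cV[R]_n :=
  ext_sigma f r k i *: moment phi (ext_t r k i).

Definition initialization (R : realType) (K : Type) (n : nat)
    (phi : 'I_n -> K -> R) (f : K -> R) (r : run R K n) : Prop :=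
  [/\ injective (r_t r 1),
      nondegenerate (fun i => moment phi (r_t r 1 i)),
      polynomial phi (r_p r 1),
      exists (x : 'I_n.+1 -> R) (d : R),
        [/\ exists i, x i != 0,
            \sum_(i < n.+1) x i *: moment phi (r_t r 1 i) = 0,
            forall i, r_p r 1 (r_t r 1 i) = f (r_t r 1 i) + Num.sg (x i) * d &
            if d < 0 then
              r_b r 1 = - d /\ forall i, r_sigma r 1 i = - Num.sg (x i)
            else
              r_b r 1 = d /\ forall i, r_sigma r 1 i = Num.sg (x i)] &
      r_B r 1 = unorm (err f r 1)].

(* [g] relabels the indices of {0..n+1} other than s as 1..n+1; it is a
   bijection between these sets since both have n+1 elements. *)
Definition relabelling (R : realType) (K : Type) (n : nat) (f : K -> R)
    (r : run R K n) (k : nat) : Prop :=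
  exists g : 'I_n.+1 -> option 'I_n.+1,
    [/\ injective g,
        forall j, g j != Some (r_s r k),
        forall j, r_t r k.+1 j = ext_t r k (g j) &
        forall j, r_sigma r k.+1 j = ext_sigma f r k (g j)].

Definition iteration (R : realType) (K : Type) (n : nat)
    (phi : 'I_n -> K -> R) (f : K -> R) (r : run R K n) (k : nat) : Prop :=
  let a := ext_a phi f r k in
  let s := r_s r k in
  [/\ [/\ forall i, 0 < r_beta r k i,
          \sum_(i < n.+1) r_beta r k i = 1 &
          \sum_(i < n.+1) r_beta r k i *: a (Some i) = 0],
      [/\ `|err f r k (r_t0 r k)| = unorm (err f r k),
          a None = \sum_(i < n.+1) r_x r k i *: a (Some i) &
          forall i, r_x r k i / r_beta r k i <= r_x r k s / r_beta r k s],
      [/\ forall i, i != Some s -> 0 <= r_alpha r k i,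
          \sum_(i | i != Some s) r_alpha r k i = 1 &
          \sum_(i | i != Some s) r_alpha r k i *: a i = 0],
      [/\ polynomial phi (r_p r k.+1),
          forall i, i != Some s ->
            r_p r k.+1 (ext_t r k i) =
            f (ext_t r k i) + ext_sigma f r k i * r_b r k.+1 &
          r_B r k.+1 = Num.min (unorm (err f r k)) (r_B r k)] &
      relabelling f r k].

(* The stopping test is checked at the start of every iteration, and the
   algorithm does not resume once it has stopped. *)
Definition performed (R : realType) (K : Type) (n : nat) (eps : R)
    (r : run R K n) (k : nat) : Prop :=
  (1 <= k)%N /\ forall j, (1 <= j <= k)%N -> eps <= r_B r j - r_b r j.

Definition algorithm1 (R : realType) (K : Type) (n : nat)
    (phi : 'I_n -> K -> R) (f : K -> R) (eps : R) (r : run R K n) : Prop :=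
  initialization phi f r /\
  forall k, performed eps r k -> iteration phi f r k.

Definition regular_case (R : realType) (K : Type) (n : nat)
    (phi : 'I_n -> K -> R) (f : K -> R) (eps : R) (r : run R K n)
    (mu : R) : Prop :=
  forall k, performed eps r k ->
    nondegenerate (ext_a phi f r k) /\ mu <= r_alpha r k None.

(* Main.v *)
Require Import Defs.
From HB Require Import structures.
From mathcomp Require Import all_boot all_order all_algebra.
From mathcomp Require Import all_classical all_reals all_analysis.
From mathcomp Require Import ring lra.
Set Implicit Arguments.
Unset Strict Implicit.
Unset Printing Implicit Defensive.
Import Order.TTheory GRing.Theory Num.Theory.
Import numFieldNormedType.Exports.
Local Open Scope classical_set_scope.
Local Open Scope ring_scope.

(** The engine of the proof is an averaging identity.  If nonnegative weights
    [alpha i] of total mass 1 satisfy [\sum_i alpha i *: a i = 0], with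
    [a i] the signed moment vectors, then [\sum_i alpha i * sigma i * p (t i)]
    vanishes for every polynomial [p].  Hence the signed mean of [p - f] over
    the points [t i] is the same for all polynomials [p]
    ([signed_mean_independent]).

    Iteration [k] evaluates this mean on the points kept together with the new
    point [t0].  For the new polynomial the signed error equals [b_(k+1)] at
    all these points.  For the old one it equals [b_k] at the points kept and
    [r_k] at [t0].  Therefore [b_(k+1) = alpha0 * r_k + (1 - alpha0) * b_k]
    ([next_level]).  Since [B_(k+1)], the minimum of [r_k] and [B_k], is at
    most [alpha0 * r_k + (1 - alpha0) * B_k], the gap [B - b] shrinks by a
    factor [1 - alpha0 <= 1 - mu] ([gap_contracts]).

    The averaging needs all signs to be [1] or [-1], whereas [Num.sg] may
    vanish.  For [n > 0] nondegeneracy forbids it, because a zero sign makes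
    some [a i] the zero vector.  For [n = 0] nondegeneracy says nothing, but
    then the only polynomial is 0, so that [r_k = r_1] for every [k]; a zero
    error at [t0] would give [B_k <= r_1 = r_k = 0 <= b_k], and the algorithm would
    have stopped. *)

Lemma nondegenerate_neq0 (R : realType) (n : nat) (I : finType)
    (v : I -> 'cV[R]_n) (i : I) :
  (0 < n)%N -> Defs.nondegenerate v -> v i != 0.
Proof.
move=> n_gt0 [le_nI freev].
have [A iA cardA] : exists2 A : {set I}, i \in A & #|A| = n.
  have cardC : #|[set~ i]%SET| = #|I|.-1 by rewrite cardsC1.
  pose s := take n.-1 (enum [set~ i]%SET).
  have szs : size s = n.-1.
    rewrite size_takel // -cardE cardC -!subn1; exact: leq_sub2r.
  have iNs : i \notin s.
    by apply/negP => /mem_take; rewrite mem_enum !inE eqxx.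
  have us : uniq (i :: s) by rewrite /= iNs take_uniq ?enum_uniq.
  exists [set x in i :: s]%SET; first by rewrite inE mem_head.
  by rewrite cardsE (card_uniqP us) /= szs prednK.
apply: (free_not0 (freev A cardA)).
by apply: map_f; rewrite mem_enum.
Qed.

Section Averaging.
Variables (R : realType) (K : Type) (n : nat) (phi : 'I_n -> K -> R).

Lemma polynomial_annihilated (I : finType) (P : pred I) (w : I -> R)
    (t : I -> K) (p : K -> R) :
  Defs.polynomial phi p -> \sum_(i | P i) w i *: moment phi (t i) = 0 ->
  \sum_(i | P i) w i * p (t i) = 0.
Proof.
move=> [c pE] w0.
under eq_bigr do rewrite pE mulr_sumr.
rewrite exchange_big big1 //= => j _.
have /(congr1 (fun M : 'cV_n => M j 0)) := w0.
rewrite summxE mxE => wj0.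
transitivity (c j * \sum_(i | P i) (w i *: moment phi (t i)) j 0).
  rewrite mulr_sumr; apply: eq_bigr => i _.
  by rewrite !mxE mulrCA.
by rewrite wj0 mulr0.
Qed.

(** Both sides are [- \sum_i alpha i * sigma i * f (t i)]. *)
Lemma signed_mean_independent (I : finType) (P : pred I) (alpha sigma : I -> R)
    (t : I -> K) (f p q : K -> R) :
  Defs.polynomial phi p -> Defs.polynomial phi q ->
  \sum_(i | P i) alpha i *: (sigma i *: moment phi (t i)) = 0 ->
  \sum_(i | P i) alpha i * (sigma i * (p (t i) - f (t i))) =
  \sum_(i | P i) alpha i * (sigma i * (q (t i) - f (t i))).
Proof.
move=> Pp Pq; under eq_bigr do rewrite scalerA.
move=> a0; apply/eqP; rewrite -subr_eq0 -sumrB; apply/eqP.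
have p0 := polynomial_annihilated Pp a0.
have q0 := polynomial_annihilated Pq a0.
transitivity (\sum_(i | P i) alpha i * sigma i * p (t i)
              - \sum_(i | P i) alpha i * sigma i * q (t i)).
  by rewrite -sumrB; apply: eq_bigr => i _; ring.
by rewrite p0 q0 subrr.
Qed.

End Averaging.

Section Algorithm.
Variables (R : realType) (K : Type) (n : nat) (phi : 'I_n -> K -> R).
Variables (f : K -> R) (eps : R) (eps_gt0 : 0 < eps) (r : run R K n).
Variables (mu : R) (mu_gt0 : 0 < mu).
Hypothesis r_alg : algorithm1 phi f eps r.
Hypothesis r_reg : regular_case phi f eps r mu.

(** The last two bounds serve only to exclude a zero error at [t0] when
    [n = 0]. *)
Definition good_state (k : nat) : Prop :=
  [/\ Defs.polynomial phi (r_p r k),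
      forall i, r_sigma r k i ^+ 2 = 1,
      forall i, err f r k (r_t r k i) = r_sigma r k i * r_b r k,
      0 <= r_b r k &
      r_B r k <= unorm (err f r 1)].

Lemma ext_sigma_neq0 (k : nat) (i : option 'I_n.+1) :
  (0 < n)%N -> performed eps r k -> ext_sigma f r k i != 0.
Proof.
move=> n_gt0 /r_reg[nondeg _].
have := nondegenerate_neq0 i n_gt0 nondeg.
by rewrite /ext_a; apply: contra_neq => ->; rewrite scale0r.
Qed.

Lemma performed_gap (k : nat) :
  performed eps r k -> 0 < r_B r k - r_b r k.
Proof.
case=> k_gt0 perf; apply: lt_le_trans eps_gt0 (perf k _).
by rewrite k_gt0 leqnn.
Qed.

Lemma good_state1 : performed eps r 1 -> good_state 1.
Proof.
move=> perf1; case: r_alg => -[_ _ polp [x [d [[i0 xi0] _ pE bE]]] BE] _.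
have x_neq0 i : x i != 0.
  case: (posnP n) => [n0|n_gt0].
    (* The only index is 0, so the nonzero entry [x i0] is [x i]. *)
    have val0 (j : 'I_n.+1) : val j = 0%N.
      by apply/eqP; rewrite -leqn0 -[X in (_ <= X)%N]n0 -ltnS ltn_ord.
    by rewrite (_ : i = i0) //; apply: val_inj; rewrite !val0.
  have := ext_sigma_neq0 (Some i) n_gt0 perf1 => /=.
  apply: contra_neq => xi.
  by case: ifP bE => _ [_ ->]; rewrite xi sgr0 ?oppr0.
have sgx i : Num.sg (x i) ^+ 2 = 1 by rewrite sqr_sg x_neq0.
split=> //; last by rewrite BE.
- by move=> i; case: ifP bE => _ [_ ->]; rewrite ?sqrrN sgx.
- move=> i; rewrite /err pE addrAC subrr add0r.
  by case: ifP bE => _ [-> ->]; rewrite ?mulrNN.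
- by case: ifP bE => [d_lt0|/negbT]; [|rewrite -leNgt => d_ge0] => -[-> _] //;
    rewrite oppr_ge0 ltW.
Qed.

Lemma ext_sigma_sqr (k : nat) (i : option 'I_n.+1) :
  performed eps r k -> good_state k -> ext_sigma f r k i ^+ 2 = 1.
Proof.
move=> perf [polk sigk _ bk_ge0 Bk]; case: i => [j|]; first exact: sigk.
rewrite /= sqr_sg.
suff -> : err f r k (r_t0 r k) != 0 by [].
case: (posnP n) => [n0|n_gt0]; last first.
  have := ext_sigma_neq0 None n_gt0 perf.
  by apply: contra_neq => /= ->; rewrite sgr0.
have zero p : Defs.polynomial phi p -> p = cst 0.
  case=> c pE; apply/funext => t; rewrite pE big1 // => j.
  by have := ltn_ord j; rewrite [X in (_ < X)%N]n0.
have rE : unorm (err f r k) = unorm (err f r 1).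
  case: r_alg => -[_ _ pol1 _ _] _.
  by congr unorm; apply/funext => t; rewrite /err (zero _ polk) (zero _ pol1).
have [_ [t0E _ _] _ _ _] := r_alg.2 k perf.
apply/eqP => e0; move: t0E (performed_gap perf) bk_ge0 Bk.
by rewrite e0 normr0 rE; lra.
Qed.

Lemma next_level (k : nat) :
  performed eps r k -> good_state k ->
  r_b r k.+1 = r_alpha r k None * unorm (err f r k)
               + (1 - r_alpha r k None) * r_b r k.
Proof.
move=> perf good; have sig2 i := ext_sigma_sqr i perf good.
case: good => polk _ errk _ _.
have [_ [t0E _ _] [_ sum1 sum0] [polk1 pE _] _] := r_alg.2 k perf.
have := signed_mean_independent f polk1 polk sum0.
have -> : \sum_(i | i != Some (r_s r k)) r_alpha r k i *
    (ext_sigma f r k i * (r_p r k.+1 (ext_t r k i) - f (ext_t r k i))) =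
    r_b r k.+1.
  rewrite -[RHS]mul1r -sum1 mulr_suml; apply: eq_bigr => i /pE ->.
  by congr (_ * _); rewrite addrAC subrr add0r mulrA -expr2 sig2 mul1r.
move=> ->.
rewrite (bigD1 None) //=; congr (_ + _).
  by rewrite -/(err f r k _) -normrEsg t0E.
have -> : 1 - r_alpha r k None =
    \sum_(i | (i != Some (r_s r k)) && (i != None)) r_alpha r k i.
  by rewrite -sum1 (bigD1 None) //= addrAC subrr add0r.
rewrite mulr_suml; apply: eq_bigr => -[j|] /andP[] // _ _.
congr (_ * _); rewrite -/(err f r k _) errk mulrA -expr2.
by have /= -> := sig2 (Some j); rewrite mul1r.
Qed.

Lemma alpha0_bounds (k : nat) :
  performed eps r k -> mu <= r_alpha r k None <= 1.
Proof.
move=> perf; have [_ ->] := r_reg perf.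
have [_ _ [alpha_ge0 sum1 _] _ _] := r_alg.2 k perf.
rewrite -sum1 (bigD1 None) //= lerDl sumr_ge0 // => i /andP[+ _].
exact: alpha_ge0.
Qed.

Lemma good_stateS (k : nat) :
  performed eps r k -> good_state k -> good_state k.+1.
Proof.
move=> perf good; have bE := next_level perf good.
have sig2 i := ext_sigma_sqr i perf good.
have /andP[mu_le alpha_le1] := alpha0_bounds perf.
case: good => _ _ _ bk_ge0 Bk.
have [_ [t0E _ _] _ [polk1 pE BE] [g [_ gs tE sE]]] := r_alg.2 k perf.
split=> //.
- by move=> j; rewrite sE sig2.
- by move=> j; rewrite /err tE sE pE ?gs // addrAC subrr add0r.
- rewrite bE -t0E addr_ge0 ?mulr_ge0 ?subr_ge0 //.
  exact: le_trans (ltW mu_gt0) mu_le.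
- by rewrite BE ge_min Bk orbT.
Qed.

Lemma performedS (k : nat) :
  (0 < k)%N -> performed eps r k.+1 -> performed eps r k.
Proof.
move=> k_gt0 [_ perf]; split=> // j /andP[j_gt0 le_jk].
by apply: perf; rewrite j_gt0 leqW.
Qed.

Lemma performed_good_state (k : nat) : performed eps r k -> good_state k.
Proof.
elim: k => [[]//|[|k] IHk perf]; first exact: good_state1.
have perf_k := performedS (ltn0Sn k) perf.
exact: good_stateS perf_k (IHk perf_k).
Qed.

Lemma gap_contracts (k : nat) :
  performed eps r k ->
  r_B r k.+1 - r_b r k.+1 <= (1 - mu) * (r_B r k - r_b r k).
Proof.
move=> perf; rewrite (next_level perf (performed_good_state perf)).
have [_ _ _ [_ _ ->] _] := r_alg.2 k perf.
have /andP[mu_le alpha_le1] := alpha0_bounds perf.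
have gap_gt0 := performed_gap perf.
set a := r_alpha _ _ _ in mu_le alpha_le1 *.
set rk := unorm _; set B := r_B r k in gap_gt0 *.
set b := r_b r k in gap_gt0 *.
have a_ge0 : 0 <= a by apply: le_trans mu_le; apply: ltW.
have min_le : Num.min rk B <= a * rk + (1 - a) * B.
  have -> : Num.min rk B = a * Num.min rk B + (1 - a) * Num.min rk B by ring.
  by rewrite lerD // ler_wpM2l ?subr_ge0 // ge_min lexx ?orbT.
apply: (@le_trans _ _ ((1 - a) * (B - b))); first by lra.
by rewrite ler_pM2r // lerB.
Qed.

Lemma gap_geometric (k : nat) :
  performed eps r k ->
  r_B r k.+1 - r_b r k.+1 <= (1 - mu) ^+ k * (r_B r 1 - r_b r 1).
Proof.
elim: k => [[]//|[|k] IHk perf]; first by rewrite expr1; exact: gap_contracts.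
apply: le_trans (gap_contracts perf) _.
have /andP[mu_le alpha_le1] := alpha0_bounds perf.
rewrite exprS -mulrA ler_wpM2l ?IHk ?subr_ge0 ?(le_trans mu_le) //.
exact: performedS.
Qed.

End Algorithm.

Theorem theorem4 (R : realType) (K : metricType R)
    (compactK : compact [set: K]) (n : nat)
    (phi : 'I_n -> K -> R) (phi_cont : forall i, continuous (phi i))
    (phi_indep : lin_indep phi)
    (f : K -> R) (f_cont : continuous f)
    (eps : R) (eps_gt0 : 0 < eps)
    (r : run R K n) (r_alg : algorithm1 phi f eps r)
    (mu : R) (mu_gt0 : 0 < mu) (r_reg : regular_case phi f eps r mu) :
  forall k : nat, performed eps r k ->
    r_B r k.+1 - r_b r k.+1 <= (1 - mu) ^+ k * (r_B r 1 - r_b r 1).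
Proof. by move=> k; apply: (gap_geometric eps_gt0 mu_gt0 r_alg r_reg). Qed.
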